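(* Let $\mathbb Z$ be the additive group of integers. (1) The semigroup $\lambda(\mathbb Z)$ contains a principal left ideal topologically isomorphic to $\prod_{k=1}^\infty C_{2^k}\wr Z_k^{Z_k}$, where $Z_k=2^{2^{k-1}-k}$. (2) Each minimal left ideal of $\lambda(\mathbb Z)$ is topologically isomorphic to $2^\omega\times\prod_{k=1}^\infty C_{2^k}$, where the Cantor cube $2^\omega$ is endowed with the left zero multiplication. (3) Each maximal group of the minimal ideal of $\lambda(\mathbb Z)$ is topologically isomorphic to $\prod_{k=1}^\infty C_{2^k}$. (4) The semigroup $\lambda(\mathbb Z)$ contains a topologically isomorphic copy of each second countable profinite topological semigroup.
   Context: Superextension. For a group $X$, $\mathsf P(X)$ is its power-set. A family $\mathcal L\subset\mathsf P(X)$ is linked if $A\cap B\ne\emptyset$ for all $A,B\in\mathcal L$, and maximal linked if it is linked and coincides with every linked family containing it. $\lambda(X)\subset\mathsf P(\mathsf P(X))$ is the set of maximal linked systems on $X$, with the subspace topology of $\mathsf P(\mathsf P(X))\cong\{0,1\}^{\mathsf P(X)}$ and the operation $\mathcal A\circ\mathcal B=\{A\subset X:\{x\in X:x^{-1}A\in\mathcal B\}\in\mathcal A\}$ (for $X=\mathbb Z$, $x^{-1}A$ is the translate $A-x$); it is a compact Hausdorff right-topological semigroup. The minimal ideal is the smallest two-sided ideal (the union of all minimal left ideals); its maximal groups are the largest subgroups containing its idempotents. A principal left ideal of a semigroup $S$ is a set $Sx$, $x\in S$. ''Topologically isomorphic'' means there is a semigroup isomorphism that is a homeomorphism. Left zero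 multiplication is $xy=x$. $C_{2^k}=\{z\in\mathbb C:z^{2^k}=1\}$; $Z_k$ is the finite set $\{0,1\}^{2^{k-1}-k}$. For a group $H$ and a set $A$, $A^A$ is the semigroup of all self-maps of $A$ under composition, and $H\wr A^A$ is the set $H^A\times A^A$ with operation $(h,f)*(h',f')=(h'',f\circ f')$, $h''(\alpha)=h(f'(\alpha))\cdot h'(\alpha)$. Finite semigroups are discrete and products carry the product topology. A profinite topological semigroup is a topological semigroup that is topologically isomorphic to a projective limit of finite discrete semigroups. *)

(* Defs.v *)
From HB Require Import structures.
From mathcomp Require Import all_boot all_order all_algebra.
From mathcomp Require Import all_classical reals topology cantor.
From mathcomp Require Import complex.

Set Implicit Arguments.
Unset Strict Implicit.
Unset Printing Implicit Defensive.

Import GRing.Theory.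

Local Open Scope classical_set_scope.

(* No compatibility between multiplication and topology is built in: a
   superextension is only right-topological.  Joint continuity is stated
   explicitly where it is needed. *)
#[short(type="tsemigroupType")]
HB.structure Definition TSemigroup := {S of Semigroup S & Topological S}.

Section Ideals.
Context {S : semigroupType}.
Implicit Types L J K G H : set S.
Local Open Scope group_scope.

Definition principal_left_ideal (x : S) : set S := range (fun s : S => s * x).

Definition left_ideal L := L !=set0 /\ forall s x, L x -> L (s * x).

Definition minimal_left_ideal L :=
  left_ideal L /\ forall J, left_ideal J -> J `<=` L -> J = L.

Definition two_sided_ideal J :=
  J !=set0 /\ forall s x, J x -> J (s * x) /\ J (x * s).

Definition minimal_ideal K :=
  two_sided_ideal K /\ forall J, two_sided_ideal J -> K `<=` J.

Definition group_with_unit G (e : S) :=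
  [/\ G e, forall x y, G x -> G y -> G (x * y),
      forall x, G x -> e * x = x /\ x * e = x
    & forall x, G x -> exists2 y, G y & x * y = e /\ y * x = e].

Definition subgroup G := exists e, group_with_unit G e.

Definition maximal_group K G :=
  exists e, [/\ K e, e * e = e,
    [/\ subgroup G, G `<=` K & G e]
  & forall H, subgroup H -> H `<=` K -> H e -> H `<=` G].

End Ideals.

(* [A] carries the subspace topology and the multiplication of [S], under which
   it is then automatically closed. *)

Definition topologically_isomorphic (S T : tsemigroupType) (A : set S) :=
  exists (f : T -> A) (g : A -> T),
    [/\ cancel f g, cancel g f,
        {morph set_val \o f : x y / (x * y)%g},
        continuous f & continuous g].
Arguments topologically_isomorphic {S} T A.

Section DiscreteSemigroup.
Context (S : semigroupType).
HB.instance Definition _ := Semigroup.copy (discrete_topology S) S.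
End DiscreteSemigroup.

Section ProductSemigroup.
Context {I : Type} (S : I -> tsemigroupType).

Definition prod_mul (x y : prod_topology S) : prod_topology S :=
  fun i => (x i * y i)%g.

Lemma prod_mulA : associative prod_mul.
Proof. by move=> x y z; apply: functional_extensionality_dep => i; exact: mulgA.
Qed.

HB.instance Definition _ := isSemigroup.Build (prod_topology S) prod_mulA.
End ProductSemigroup.

Section PairSemigroup.
Context (S T : tsemigroupType).

Definition pair_mul (x y : S * T) : S * T := ((x.1 * y.1)%g, (x.2 * y.2)%g).

Lemma pair_mulA : associative pair_mul.
Proof. by move=> x y z; rewrite /pair_mul /= !mulgA. Qed.

HB.instance Definition _ := isSemigroup.Build (S * T)%type pair_mulA.
End PairSemigroup.

Definition left_zero_semigroup (T : Type) : Type := T.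

Section LeftZero.
Context (T : topologicalType).

Definition left_zero_mul (x y : left_zero_semigroup T) : left_zero_semigroup T := x.

Lemma left_zero_mulA : associative left_zero_mul.
Proof. by []. Qed.

HB.instance Definition _ := Topological.copy (left_zero_semigroup T) T.
HB.instance Definition _ := isSemigroup.Build (left_zero_semigroup T) left_zero_mulA.
End LeftZero.

(* Only used, through [discrete_topology], for finite [H] and [A]. *)
Definition wreath (H A : Type) : Type := ((A -> H) * (A -> A))%type.

Section Wreath.
Context (H : semigroupType) (A : Type).
HB.instance Definition _ := gen_eqMixin (wreath H A).
HB.instance Definition _ := gen_choiceMixin (wreath H A).

Definition wreath_mul (u v : wreath H A) : wreath H A :=
  (fun a => u.1 (v.2 a) * v.1 a, u.2 \o v.2)%g.

Lemma wreath_mulA : associative wreath_mul.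
Proof.
by move=> u v w; congr pair; apply/funext => a /=; rewrite mulgA.
Qed.

HB.instance Definition _ := isSemigroup.Build (wreath H A) wreath_mulA.
End Wreath.

Section RootsOfUnity.
Context (R : realType).
Local Open Scope ring_scope.

Definition croots (n : nat) : Type := {z : R[i] | z ^+ n == 1}.

Section Mul.
Context (n : nat).
HB.instance Definition _ := SubChoice.on (croots n).

Lemma croots_mul_subproof (x y : croots n) : (val x * val y) ^+ n == 1.
Proof. by rewrite exprMn (eqP (valP x)) (eqP (valP y)) mulr1. Qed.

Definition croots_mul (x y : croots n) : croots n :=
  exist _ (val x * val y) (croots_mul_subproof x y).

Lemma croots_mulA : associative croots_mul.
Proof. by move=> x y z; apply: val_inj; rewrite /= mulrA. Qed.

HB.instance Definition _ := isSemigroup.Build (croots n) croots_mulA.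
End Mul.
End RootsOfUnity.

(* For [k >= 1] the truncated subtraction is the true one, since
   [k <= 2 ^ (k - 1)]. *)
Definition Zset (k : nat) : Type := 'I_(2 ^ k.-1 - k) -> bool.

(* Bonding maps need not be surjective. *)
Record inverse_system d (I : porderType d) := InverseSystem {
  isys :> I -> semigroupType;
  bond : forall i j, (i <= j)%O -> isys j -> isys i;
  bondM : forall i j (ij : (i <= j)%O), {morph bond ij : x y / (x * y)%g};
  bond_id : forall i (ii : (i <= i)%O) x, bond ii x = x;
  bond_comp : forall i j k (ij : (i <= j)%O) (jk : (j <= k)%O)
    (ik : (i <= k)%O) x, bond ij (bond jk x) = bond ik x }.

Definition projective_limit d (I : porderType d) (S : inverse_system I) :
    set (prod_topology (fun i => discrete_topology (S i))) :=
  [set x | forall i j (ij : (i <= j)%O), bond ij (x j) = x i].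
Arguments projective_limit {d I} S _.

Definition topological_semigroup (T : tsemigroupType) :=
  continuous (fun p : T * T => (p.1 * p.2)%g).

Definition profinite (T : tsemigroupType) :=
  exists d (I : porderType d) (S : inverse_system I),
    [/\ inhabited I, forall i j : I, exists2 k, (i <= k)%O & (j <= k)%O,
        forall i, finite_set [set: S i]
      & topologically_isomorphic T (projective_limit S)].

Section Linked.
Context {X : Type}.
Implicit Types L M : set (set X).

Definition linked L := forall A B, L A -> L B -> A `&` B !=set0.

Definition maximal_linked L :=
  linked L /\ forall M, linked M -> L `<=` M -> L = M.

Lemma maximal_linked_setT (x : X) L : maximal_linked L -> L setT.
Proof.
move=> [lL mL]; rewrite (mL (setT |` L)); [by left| |by right].
have inh A : L A -> A !=set0 by move=> LA; have := lL _ _ LA LA; rewrite setIid.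
move=> A B [->|LA] [->|LB].
- by exists x.
- by rewrite setTI; exact: inh.
- by rewrite setIT; exact: inh.
- exact: lL.
Qed.

Lemma maximal_linked_up L A B : maximal_linked L -> L A -> A `<=` B -> L B.
Proof.
move=> [lL mL] LA AB; rewrite (mL (B |` L)); [by left| |by right].
move=> C D [->|LC] [->|LD].
- by have [z [/AB Bz _]] := lL _ _ LA LA; exists z.
- by have [z [/AB Bz Dz]] := lL _ _ LA LD; exists z.
- by have [z [Cz /AB Bz]] := lL _ _ LC LA; exists z.
- exact: lL.
Qed.

Lemma maximal_linkedC (x : X) L A : maximal_linked L -> ~ L A -> L (~` A).
Proof.
move=> mlL nLA; have [lL mL] := mlL.
have [[B LB AB]|noB] := pselect (exists2 B, L B & A `&` B = set0).
  apply: maximal_linked_up mlL LB _ => z Bz Az.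
  by have : (A `&` B) z by []; rewrite AB.
exfalso; apply: nLA; rewrite (mL (A |` L)); [by left| |by right].
have meet B : L B -> A `&` B !=set0.
  by move=> LB; apply/set0P/eqP => AB; apply: noB; exists B.
move=> C D [->|LC] [->|LD].
- have [z [Az _]] := meet _ (maximal_linked_setT x mlL); by exists z.
- exact: meet.
- by rewrite setIC; exact: meet.
- exact: lL.
Qed.

Lemma maximal_linkedP L :
  linked L -> (forall A, L A \/ L (~` A)) -> maximal_linked L.
Proof.
move=> lL LC; split=> // M lM LM; apply/seteqP; split=> // A MA.
have [//|/LM MnA] := LC A.
by have [z []] := lM _ _ MA MnA.
Qed.

End Linked.

Definition superextension (X : Type) : Type :=
  set_type [set L : set (set X) | maximal_linked L].

(* [indicator] identifies [set (set X)] with [{0,1}^(set X)]. *)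
Definition indicator (X : Type) (L : superextension X) :
    prod_topology (fun _ : set X => bool) :=
  fun A => `[< set_val L A >].

Section SuperextensionTopology.
Context (X : Type).
HB.instance Definition _ := Choice.on (superextension X).
HB.instance Definition _ :=
  Topological.copy (superextension X) (initial_topology (@indicator X)).
End SuperextensionTopology.

Section SuperextensionSemigroup.
Context (X : zmodType).
Local Open Scope ring_scope.

(* [[set y | A (x + y)]] is the translate [A - x]. *)
Definition family_mul (L M : set (set X)) : set (set X) :=
  [set A | L [set x | M [set y | A (x + y)]]].

Lemma family_mul_maximal_linked L M :
  maximal_linked L -> maximal_linked M -> maximal_linked (family_mul L M).
Proof.
move=> mlL mlM; apply: maximal_linkedP => [A B LA LB|A].
  have [x [MA MB]] := mlL.1 _ _ LA LB.
  by have [y [Ay By]] := mlM.1 _ _ MA MB; exists (x + y).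
have [|nLA] := pselect (family_mul L M A); [by left|right].
apply: maximal_linked_up mlL (maximal_linkedC 0 mlL nLA) _ => x /= nMA.
by have := maximal_linkedC 0 mlM nMA.
Qed.

Lemma superextension_mul_subproof (L M : superextension X) :
  family_mul (set_val L) (set_val M) \in
    [set L : set (set X) | maximal_linked L].
Proof.
by apply/mem_set/family_mul_maximal_linked; exact: set_valP.
Qed.

Definition superextension_mul (L M : superextension X) : superextension X :=
  exist _ (family_mul (set_val L) (set_val M)) (superextension_mul_subproof L M).

Lemma superextension_mulA : associative superextension_mul.
Proof.
move=> L M N; apply: val_inj => /=; rewrite set_valE /= /family_mul /=.
apply/funext => A; congr (set_val L _); apply/funext => x.
congr (set_val M _); apply/funext => y.
by congr (set_val N _); apply/funext => z; rewrite /= addrA.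
Qed.

HB.instance Definition _ :=
  isSemigroup.Build (superextension X) superextension_mulA.
End SuperextensionSemigroup.

(* Main.v *)
(* A maximal linked system [l] amounts to the self-map [A |-> {x | A - x in l}]
   of the power set of [Z], which commutes with translations and complements and
   is monotone; the product becomes composition.  Such a map preserves, for each
   [n], the set of dyadic sets [A] of level [n], those with [A + 2^n = ~ A].
   These form a free [C_{2^(n+1)}]-set with [2^(2^n - (n+1))] orbits, whose
   equivariant self-maps are the wreath product
   [C_{2^(n+1)} wr Z_{n+1}^{Z_{n+1}}].

   Call [A] twin if some translate of [A] is its complement.  Distinct twin sets
   are incomparable for inclusion, and if [M] is a maximal
   translation-invariant linked family, then every set is twin, in [M], or has
   its complement in [M].  Hence any equivariant complement-preserving map [r]
   on twin sets extends to a monotone one, sending [M] to [Z] and the complements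
   of members of [M] to the empty set.  Taking for [r] a retraction of the twin
   sets onto the dyadic ones gives an idempotent [e] whose left ideal
   [lambda(Z) e] is the product of the wreath products.  Following it by maps
   with values in a single orbit of each level describes every minimal left
   ideal and every maximal group of the minimal ideal.  A second countable
   profinite semigroup embeds in a countable product of finite semigroups [S],
   and [S] embeds in the self-maps of [Z_n] for all large [n]. *)
Require Import Defs.
From HB Require Import structures.
From mathcomp Require Import all_boot all_order all_algebra.
From mathcomp Require Import all_classical reals topology cantor.
From mathcomp Require Import complex zify ring.

Set Implicit Arguments.
Unset Strict Implicit.
Unset Printing Implicit Defensive.

Local Open Scope classical_set_scope.

Import Order.TTheory GRing.Theory Num.Theory.
Local Open Scope ring_scope.

(** * Twin sets and a maximal invariant linked family *)

(* [translate x A] is [A - x]. *)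
Definition translate (x : int) (A : set int) : set int := [set y | A (x + y)].

Lemma translate0 A : translate 0 A = A.
Proof. by apply/funext => y; rewrite /translate /= add0r. Qed.

Lemma translateD x y A : translate x (translate y A) = translate (x + y) A.
Proof. by apply/funext => z; rewrite /translate /= addrA (addrC y). Qed.

Lemma translateK x : cancel (translate x) (translate (- x)).
Proof. by move=> A; rewrite translateD addNr translate0. Qed.

Lemma translateC x A : translate x (~` A) = ~` translate x A.
Proof. by []. Qed.

Lemma sub_translate x A B : A `<=` B -> translate x A `<=` translate x B.
Proof. by move=> AB y; exact: AB. Qed.

Lemma neq_setC (A : set int) : A <> ~` A.
Proof.
by move=> AE; have [A0|nA0] := pselect (A 0);
  [move: (A0)|apply: (nA0)]; rewrite AE.
Qed.

Lemma translate_period d A q : translate d A = A -> translate (d * q) A = A.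
Proof.
move=> dA.
have natq (n : nat) : translate (d * n%:Z) A = A.
  elim: n => [|n IHn]; first by rewrite mulr0 translate0.
  by rewrite intS mulrDr mulr1 -translateD IHn dA.
case: q => [n|n]; first exact: natq.
by rewrite NegzE mulrN -{1}(natq n.+1) translateD addNr translate0.
Qed.

Lemma translate_antiperiod_even d A q :
  translate d A = ~` A -> translate (d * (2 * q)) A = A.
Proof.
move=> dA; rewrite mulrA; apply: translate_period.
by rewrite mulrDr mulr1 -translateD dA translateC dA setCK.
Qed.

Lemma translate_antiperiod_odd d A q :
  translate d A = ~` A -> translate (d * (2 * q + 1)) A = ~` A.
Proof.
move=> dA; rewrite mulrDr mulr1 addrC -translateD.
by rewrite translate_antiperiod_even.
Qed.

(** The level [n] is the 2-adic valuation of an antiperiod; [twin_at_inj] shows that it depends on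
    [A] alone. *)
Definition twin_at (n : nat) (A : set int) :=
  exists q : int, translate (2 ^+ n * (2 * q + 1)) A = ~` A.

Definition twin (A : set int) := exists d, translate d A = ~` A.

Lemma int_parity (q : int) : exists r : int, q = 2 * r \/ q = 2 * r + 1.
Proof. exists (q %/ 2)%Z; lia. Qed.

Lemma int_2adic (d : int) : d != 0 ->
  exists n (q : int), d = 2 ^+ n * (2 * q + 1).
Proof.
have [m] := ubnP `|d|%N; elim: m d => // m IHm d dm d0.
have [r [dE|dE]] := int_parity d; last by exists 0, r; rewrite expr0 mul1r.
have [||n [q rE]] := IHm r; [lia..|].
by exists n.+1, q; rewrite dE rE exprS mulrA.
Qed.

Lemma twin_level A : twin A -> exists n, twin_at n A.
Proof.
move=> [d dA]; have d0 : d != 0.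
  by apply/eqP => d0; move: dA; rewrite d0 translate0; exact: neq_setC.
by have [n [q dE]] := int_2adic d0; exists n, q; rewrite -dE.
Qed.

Lemma twin_at_twin n A : twin_at n A -> twin A.
Proof. by move=> [q]; eexists; eassumption. Qed.

(** If [e] were [2 ^+ i] times an odd number with [i <= n], some multiple of [e] would be an odd
    multiple of the antiperiod, hence a period and an antiperiod at once. *)
Lemma twin_at_period n A e : twin_at n A -> translate e A = A ->
  exists q : int, e = 2 ^+ n.+1 * q.
Proof.
move=> [j jA] eA; suff H i : (i <= n.+1)%N -> exists q : int, e = 2 ^+ i * q.
  exact: H.
elim: i => [|i IHi] lin; first by exists e; rewrite expr0 mul1r.
have [q eE] := IHi (ltnW lin); have [r [qE|qE]] := int_parity q.
  by exists r; rewrite eE qE exprSr mulrA.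
exfalso; apply: (@neq_setC A); rewrite -[RHS](translate_antiperiod_odd r jA).
rewrite -[LHS](translate_period (2 ^+ (n - i) * (2 * j + 1)) eA).
congr (translate _ A).
have nE : 2 ^+ n = 2 ^+ (n - i) * 2 ^+ i :> int by rewrite -exprD subnK.
by rewrite eE qE nE; ring.
Qed.


Lemma twin_at_le n m A : twin_at n A -> twin_at m A -> (n <= m)%N.
Proof.
move=> nA [q mA]; rewrite leqNgt; apply/negP => mn.
have [r] := twin_at_period nA (translate_antiperiod_even 1 mA).
have -> : 2 ^+ n.+1 * r = 2 ^+ m * (2 * (2 ^+ (n - m) * r)) :> int.
  by rewrite -[in LHS](subnK (ltnW mn)) -addSn exprD exprS; ring.
have -> : 2 ^+ m * (2 * q + 1) * (2 * 1) = 2 ^+ m * (2 * (2 * q + 1)) :> int.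
  by ring.
move=> /mulfI; rewrite expf_eq0 andbF => /(_ isT).
by rewrite -(subnSK mn) exprS; lia.
Qed.

Lemma twin_at_inj n m A : twin_at n A -> twin_at m A -> n = m.
Proof. by move=> nA mA; apply/eqP; rewrite eqn_leq !(@twin_at_le _ _ A). Qed.

Lemma twin_at_translate n A x : twin_at n A -> twin_at n (translate x A).
Proof.
move=> [q nA]; exists q.
by rewrite translateD addrC -translateD nA translateC.
Qed.

Lemma twin_at_setC n A : twin_at n A -> twin_at n (~` A).
Proof. by move=> [q nA]; exists q; rewrite translateC nA. Qed.

Lemma twin_translate A x : twin A -> twin (translate x A).
Proof.
by move=> [d dA]; exists d; rewrite translateD addrC -translateD dA translateC.
Qed.

Lemma twin_setC A : twin A -> twin (~` A).
Proof. by move=> [d dA]; exists d; rewrite translateC dA. Qed.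

Lemma not_twin_subC A : twin A -> ~ A `<=` ~` A.
Proof.
move=> [d dA] AC; have A0 : A = set0.
  by apply/seteqP; split=> // x Ax; exact: (AC _ Ax Ax).
by have : translate d A 0; [rewrite dA A0 setC0|rewrite A0].
Qed.

(* Translating both sets by a common multiple of their antiperiods turns
   [A `<=` B] into an inclusion that, together with it, forces [A = B] when the
   levels agree and is absurd otherwise. *)
Lemma twin_sub_eq A B : twin A -> twin B -> A `<=` B -> A = B.
Proof.
wlog : A B / exists n m, [/\ twin_at n A, twin_at m B & (n <= m)%N].
  move=> W tA tB AB; have [n nA] := twin_level tA; have [m mB] := twin_level tB.
  have [nm|mn] := leqP n m; first by apply: W => //; exists n, m.
  apply: setC_inj; apply/esym; apply: W; [|exact: twin_setC..|exact: subsetC].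
  by exists m, n; split; [exact: twin_at_setC..|exact: ltnW].
move=> [n [m [[q nA] [r mB] nm]]] tA tB AB.
have [nmE|nm'] := eqVneq n m.
  subst m; apply/seteqP; split=> //.
  have := sub_translate (x := 2 ^+ n * (2 * q + 1) * (2 * r + 1)) AB.
  rewrite (translate_antiperiod_odd _ nA) mulrAC.
  rewrite (translate_antiperiod_odd _ mB).
  by move=> /subsetC; rewrite !setCK.
have {nm nm'} nm : (n < m)%N by rewrite ltn_neqAle nm'.
have := sub_translate (x := 2 ^+ m * (2 * r + 1) * (2 * q + 1)) AB.
rewrite (translate_antiperiod_odd _ mB).
have -> : 2 ^+ m * (2 * r + 1) * (2 * q + 1) =
    2 ^+ n * (2 * q + 1) * (2 * (2 ^+ (m - n.+1) * (2 * r + 1))) :> int.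
  by rewrite -[in LHS](subnKC nm) exprD exprS; ring.
rewrite (translate_antiperiod_even _ nA) => ABC.
by case: (not_twin_subC tA); apply: subset_trans (subsetC AB).
Qed.

Definition invariant_linked (M : set (set int)) :=
  linked M /\ forall x A, M A -> M (translate x A).

Lemma maximal_invariant_linked_exists : exists M, invariant_linked M /\
  forall N, invariant_linked N -> M `<=` N -> N = M.
Proof.
have [F Fil tF|M [Mil Mmax]] := @Zorn_bigcup _ invariant_linked.
  split=> [A B [N FN NA] [N' FN' N'B]|x A [N FN NA]]; last first.
    by exists N => //; apply: (Fil _ FN).2.
  have [NN'|N'N] := tF _ _ FN FN'.
    by apply: (Fil _ FN').1 => //; exact: NN'.
  by apply: (Fil _ FN).1 => //; exact: N'N.
exists M; split=> // N Nil MN; apply: contrapT => NM; apply: (Mmax N) => //.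
by split=> [|NM']; [|apply: NM; apply/seteqP].
Qed.

(** The family [M] of the overview, fixed once. Its maximality is among invariant linked families:
    containing no twin set, it is not maximal linked. *)
Definition hub : set (set int) := projT1 (cid maximal_invariant_linked_exists).

Lemma hub_linked : linked hub.
Proof. by rewrite /hub; case: cid => M [[]]. Qed.

Lemma hub_translate x A : hub A -> hub (translate x A).
Proof. by rewrite /hub; case: cid => M /= [[_ +] _]; apply. Qed.

Lemma hub_max N : invariant_linked N -> hub `<=` N -> N = hub.
Proof. by rewrite /hub; case: cid => M /= [_ +]; apply. Qed.

(** Adjoining all translates of [A] keeps the family invariant, and the two hypotheses keep it
    linked; maximality then puts [A] in [hub]. *)
Lemma hub_intro A :
  (forall x, A `&` translate x A !=set0) ->
  (forall B, hub B -> A `&` B !=set0) -> hub A.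
Proof.
move=> AA AB; suff <- : hub `|` range (translate^~ A) = hub.
  by right; exists 0 => //; rewrite translate0.
apply: hub_max; last by move=> B; left.
have AB' x B : hub B -> translate x A `&` B !=set0.
  move=> /(hub_translate (- x)) /AB [y [Ay By]]; exists (- x + y).
  by split=> //; rewrite /translate /= addrA subrr add0r.
split=> [B C [hB|[x _ <-]] [hC|[y _ <-]]|x B [hB|[y _ <-]]].
- exact: hub_linked.
- by rewrite setIC; exact: AB'.
- exact: AB'.
- have [z [Az Az']] := AA (y - x); exists (- x + z).
  by split; move: Az Az'; rewrite /translate /= addrA ?subrr ?add0r ?addrA.
- by left; exact: hub_translate.
- by right; exists (x + y) => //; rewrite translateD.
Qed.

Lemma hub_up A B : hub A -> A `<=` B -> hub B.
Proof.
move=> hA AB; apply: hub_intro => [x|C hC].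
  have [y [Ay Axy]] := hub_linked hA (hub_translate x hA).
  by exists y; split; exact: AB.
by have [y [Ay Cy]] := hub_linked hA hC; exists y; split=> //; exact: AB.
Qed.

Lemma hub_not_twin A : hub A -> ~ twin A.
Proof.
move=> hA [d dA]; have [x []] := hub_linked hA (hub_translate d hA).
by rewrite dA.
Qed.

Lemma hub_notC A : hub A -> ~ hub (~` A).
Proof. by move=> hA hAC; have [x []] := hub_linked hA hAC. Qed.

(* [Z] is twinic: if [A] is disjoint from a translate of itself and covers [Z]
   together with another one, both translates equal the complement of [A]. *)
Lemma hub_or_twin A : [\/ twin A, hub A | hub (~` A)].
Proof.
(* A set outside [hub] misses some translate of itself or some member of [hub]; in the second case
   its complement contains that member and lies in [hub]. *)
have disj B : ~ hub B -> ~ hub (~` B) -> exists x, B `&` translate x B = set0.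
  move=> nB nBC; apply: contrapT => BB; apply: nB; apply: hub_intro => [x|C hC].
    by apply/set0P/eqP => E; apply: BB; exists x.
  apply/set0P/eqP => /disjoints_subset/subsetC.
  by rewrite setCK => /(hub_up hC).
have [hA|nA] := pselect (hub A); first exact: Or32.
have [hA|nAC] := pselect (hub (~` A)); first exact: Or33.
have [x /disjoints_subset xA] := disj _ nA nAC.
have [|y /disjoints_subset] := disj _ nAC; first by rewrite setCK.
rewrite translateC setCK => yA.
have opp B z : B `<=` ~` translate z B -> B `<=` ~` translate (- z) B.
  move=> /(sub_translate (x := - z)); rewrite translateC translateK.
  by move=> /subsetC; rewrite setCK.
have yA' : ~` A `<=` translate (- y) A.
  by have := opp (~` A) y; rewrite !translateC !setCK; exact.
have xAC : translate x A `<=` ~` A by move/subsetC: xA; rewrite setCK.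
apply: Or31; exists x; apply/seteqP; split=> //; apply: subset_trans yA _.
have := opp _ _ xA => /subsetC; rewrite setCK.
move=> /subset_trans/(_ yA')/(sub_translate (x := x + y)).
by rewrite !translateD addrAC subrr add0r addrK.
Qed.

(** * Maximal linked systems from equivariant maps of twin sets *)

Definition translates (L : set (set int)) (A : set int) : set int :=
  [set x | L (translate x A)].

(** The sets whose image under the extended [r] contains 0, where the extension sends members of
    [hub] to [setT] and their complements to [set0]. *)
Definition spread (r : set int -> set int) : set (set int) :=
  [set A | hub A \/ twin A /\ r A 0].

Section Spread.
Variable r : set int -> set int.
Hypothesis r_translate :
  forall x A, twin A -> r (translate x A) = translate x (r A).
Hypothesis r_setC : forall A, twin A -> r (~` A) = ~` r A.

(** Two disjoint twin sets are complementary by [twin_sub_eq], and then [r] cannot put 0 in both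
    images. A member of [hub] meets every twin set because [hub] is upward closed and has no twin
    member. *)
Lemma spread_maximal_linked : maximal_linked (spread r).
Proof.
have hubC A B : hub A -> twin B -> A `&` B !=set0.
  move=> hA tB; apply/set0P/eqP => /disjoints_subset /(hub_up hA).
  by move=> /hub_not_twin; apply; exact: twin_setC.
apply: maximal_linkedP => [A B [hA|[tA rA]] [hB|[tB rB]]|A].
- exact: hub_linked.
- exact: hubC.
- by rewrite setIC; exact: hubC.
- apply/set0P/eqP => /disjoints_subset AB.
  by move: rA; rewrite (twin_sub_eq tA (twin_setC tB) AB) r_setC.
have [tA|hA|hA] := hub_or_twin A; [|by left; left|by right; left].
have [rA|rA] := pselect (r A 0); [by left; right|right; right].
by split; [exact: twin_setC|rewrite r_setC].
Qed.

Lemma translates_spread_hub A : hub A -> translates (spread r) A = setT.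
Proof.
by move=> hA; apply/seteqP; split=> // x _; left; exact: hub_translate.
Qed.

Lemma translates_spread_hubC A : hub (~` A) -> translates (spread r) A = set0.
Proof.
move=> hA; apply/seteqP; split=> // x [/(hub_translate (- x))|[tA _]].
  by rewrite translateK => /hub_notC.
apply: (hub_not_twin hA); apply: twin_setC.
by rewrite -(translateK x A); exact: twin_translate.
Qed.

Lemma translates_spread_twin A : twin A -> translates (spread r) A = r A.
Proof.
move=> tA; apply/seteqP; split=> x.
  move=> [/hub_not_twin[]|[_]]; first exact: twin_translate.
  by rewrite r_translate // /translate /= addr0.
move=> rAx; right; split; first exact: twin_translate.
by rewrite r_translate // /translate /= addr0.
Qed.

End Spread.

(** * Roots of unity of order a power of two *)

Section PrimitiveRoots.
Context {R : realType}.
Implicit Types (n : nat) (x y : int).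

Definition zeta n : R[i] := iter n sqrtC (-1).

Lemma zetaE n : zeta n ^+ (2 ^ n) = -1.
Proof.
elim: n => [|n IHn]; first by rewrite expn0 expr1.
by rewrite expnS exprM /zeta iterS sqrtCK.
Qed.

Lemma zeta_prim n : (2 ^ n.+1).-primitive_root (zeta n).
Proof.
have zn1 : zeta n ^+ (2 ^ n.+1) = 1 by rewrite expnSr exprM zetaE sqrrN expr1n.
have [|m mprim] := prim_order_exists _ zn1; first by rewrite expn_gt0.
case/(dvdn_pfactor _ _ (isT : prime 2)) => e le_e mE; rewrite mE in mprim.
suff <- : e = n.+1 by [].
apply/eqP; rewrite eqn_leq le_e ltnNge; apply/negP => le_en.
have : (2 ^ e %| 2 ^ n)%N by apply: dvdn_exp2l.
rewrite (prim_order_dvd mprim).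
by rewrite zetaE -subr_eq0 -opprD oppr_eq0 (pnatr_eq0 _ 2).
Qed.

Lemma zeta_unity n x : (zeta n ^ x) ^+ (2 ^ n.+1) == 1.
Proof.
rewrite exprnP exprz_exp mulrC -exprz_exp -exprnP.
by rewrite (prim_expr_order (zeta_prim n)) exp1rz.
Qed.

Definition rootz n x : croots R (2 ^ n.+1) :=
  exist _ (zeta n ^ x) (zeta_unity n x).

Lemma zeta_neq0 n : zeta n != 0.
Proof. by rewrite (prim_root_eq0 (zeta_prim n)) expn_eq0. Qed.

Lemma rootzD n x y : rootz n (x + y) = (rootz n x * rootz n y)%g.
Proof. by apply: val_inj; rewrite /= expfzDr ?zeta_neq0. Qed.

Lemma zeta_eq1 n x : (zeta n ^ x == 1) = (2 ^ n.+1 %| `|x|)%N.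
Proof.
case: x => m; first by rewrite -exprnP -(prim_order_dvd (zeta_prim n)).
rewrite NegzE -invr_expz invr_eq1 -exprnP abszN absz_nat.
by rewrite -(prim_order_dvd (zeta_prim n)).
Qed.

Lemma rootz_eq n x y :
  rootz n x = rootz n y <-> exists q : int, x - y = 2 ^+ n.+1 * q.
Proof.
have zy : zeta n ^ y \is a GRing.unit by rewrite unitfE expfz_neq0 ?zeta_neq0.
transitivity (2 ^ n.+1 %| `|x - y|)%N.
  rewrite -zeta_eq1 expfzDr ?zeta_neq0 // -invr_expz.
  split=> [[->]|/eqP E]; first by rewrite mulrV.
  by apply: val_inj; rewrite /= -[LHS](divrK zy) E mul1r.
split=> [xy|[q ->]]; last by rewrite abszM abszX dvdn_mulr.
have /dvdzP[q ->] : ((2 ^ n.+1)%N%:Z %| x - y)%Z by [].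
by exists q; rewrite mulrC -natz natrX.
Qed.

Lemma rootz_surj n c : exists x, rootz n x = c.
Proof.
have [i cE] := prim_rootP (zeta_prim n) (eqP (valP c)).
by exists (val i)%:Z; apply: val_inj.
Qed.

Lemma crootsC k (c d : croots R k) : (c * d = d * c)%g.
Proof. by apply: val_inj; rewrite /= mulrC. Qed.

Lemma rootz0 n c : (rootz n 0 * c = c)%g.
Proof. by apply: val_inj; rewrite /= expr0z mul1r. Qed.

(** A choice of discrete logarithm; only its class modulo [2 ^ n.+1] is meaningful. *)
Definition clog n (c : croots R (2 ^ n.+1)) : int :=
  projT1 (cid (rootz_surj c)).

Lemma clogK n : cancel (@clog n) (rootz n).
Proof. by move=> c; rewrite /clog; case: cid. Qed.

End PrimitiveRoots.

(** * Orbits of dyadic sets *)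

Definition dyadic (n : nat) (A : set int) := translate (2 ^+ n) A = ~` A.

Lemma dyadic_twin_at n A : dyadic n A -> twin_at n A.
Proof. by exists 0; rewrite mulr0 add0r mulr1. Qed.

Lemma dyadic_translate n A x : dyadic n A -> dyadic n (translate x A).
Proof.
by move=> nA; rewrite /dyadic translateD addrC -translateD nA translateC.
Qed.

Lemma dyadic_mod n A x : dyadic n A ->
  translate (x %% 2 ^+ n.+1)%Z A = translate x A.
Proof.
move=> nA; set r := (x %% _)%Z.
have := translate_antiperiod_even (x %/ 2 ^+ n.+1)%Z (dyadic_translate r nA).
by rewrite translateD mulrA -exprSr mulrC -divz_eq => ->.
Qed.

Section Orbits.
Variable n : nat.
Let D : int := 2 ^+ n.
Let Y := {ffun 'I_(2 ^ n) -> bool}.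

Let D_gt0 : 0 < D. Proof. by rewrite exprn_gt0. Qed.
Let absD : `|D|%N = (2 ^ n)%N. Proof. by rewrite /D abszX. Qed.

(* A dyadic set of level [n] is determined by its trace on [[0, 2 ^ n[], and every
   trace occurs. *)
Definition window (A : set int) : Y :=
  [ffun i : 'I_(2 ^ n) => `[< A (val i)%:Z >]].

(** Each block of length [2 ^ n] carries the trace, complemented on blocks of odd index. The default
    [false] is never reached, since remainders are less than [2 ^ n]. *)
Definition of_window (f : Y) : set int :=
  [set x | oapp f false (insub `|(x %% D)%Z|%N) (+) odd `|(x %/ D)%Z|].

Lemma dyadic_of_window f : dyadic n (of_window f).
Proof.
apply/funext => x; rewrite /translate /of_window /= -/D modzDl divzDl ?dvdzz //.
rewrite divzz (gt_eqF D_gt0) /=.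
have -> : odd `|1 + (x %/ D)%Z| = ~~ odd `|(x %/ D)%Z| by lia.
by rewrite addbN; apply/propext; split=> /negP.
Qed.

Lemma of_windowK : cancel of_window window.
Proof.
move=> f; apply/ffunP => i; rewrite ffunE /of_window /=.
have iD : 0 <= (val i)%:Z < D.
  by rewrite lez_nat leq0n -(gtz0_abs D_gt0) absD ltz_nat ltn_ord.
rewrite modz_small ?divz_small ?gtz0_abs ?absz_nat ?addbF //.
by rewrite insubT //= => ltin; rewrite asboolb; congr (f _); apply: val_inj.
Qed.

Lemma window_inj A B : dyadic n A -> dyadic n B -> window A = window B -> A = B.
Proof.
move=> nA nB AB; apply/funext => x.
have xE := divz_eq x D; set q := (x %/ D)%Z in xE; set r := (x %% D)%Z in xE.
have r0 : 0 <= r by rewrite modz_ge0 ?gt_eqF.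
have rD : (`|r| < 2 ^ n)%N by rewrite -absD; have := ltz_pmod x D_gt0; lia.
have ABr : A r = B r.
  move/ffunP/(_ (Ordinal rD)): AB; rewrite !ffunE /= gez0_abs // => AB.
  by apply/propext; split=> /asboolP; [rewrite AB|rewrite -AB] => /asboolP.
have [k [qE|qE]] := int_parity q.
  have tr C : dyadic n C -> C x = C r.
    move=> /(translate_antiperiod_even k) CE; rewrite -[in RHS]CE xE qE.
    by rewrite (mulrC _ D).
  by rewrite !tr.
have tr C : dyadic n C -> C x = (~` C) r.
  move=> /(translate_antiperiod_odd k) CE; rewrite -CE xE qE.
  by rewrite (mulrC _ D).
by rewrite !tr // /setC /= ABr.
Qed.

Lemma windowK A : dyadic n A -> of_window (window A) = A.
Proof.
move=> nA; apply: window_inj => //; first exact: dyadic_of_window.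
by rewrite of_windowK.
Qed.

Definition rotate (f : Y) : Y := window (translate 1 (of_window f)).

Lemma iter_rotate k f : iter k rotate f = window (translate k%:Z (of_window f)).
Proof.
elim: k => [|k IHk]; first by rewrite translate0 of_windowK.
rewrite iterS IHk /rotate windowK; last exact/dyadic_translate/dyadic_of_window.
by rewrite translateD intS.
Qed.

Lemma rotate_inj : injective rotate.
Proof.
move=> f g /window_inj E; apply: (can_inj of_windowK).
apply: (can_inj (translateK 1)); apply: E;
exact/dyadic_translate/dyadic_of_window.
Qed.

(** An iterate fixes [f] exactly when its exponent is a period of the dyadic set, that is, a
    multiple of [2 ^ n.+1]. *)
Lemma rotate_order f : order rotate f = (2 ^ n.+1)%N.
Proof.
have fix_rotate k : iter k rotate f = f <-> (2 ^ n.+1 %| k)%N.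
  split=> [|/dvdnP[q ->]].
    rewrite iter_rotate => E.
    have : translate k%:Z (of_window f) = of_window f.
      by rewrite -[LHS]windowK ?E //; exact/dyadic_translate/dyadic_of_window.
    have /twin_at_period/[apply] := dyadic_twin_at (dyadic_of_window f).
    move=> [q /(congr1 absz)].
    by rewrite absz_nat abszM abszX => ->; rewrite dvdn_mulr.
  rewrite iter_rotate -[in RHS](of_windowK f); congr (window _).
  have -> : (q * 2 ^ n.+1)%N%:Z = D * (2 * q%:Z).
    by rewrite PoszM -[(2 ^ n.+1)%N%:Z]natz natrX exprS /D; ring.
  exact/translate_antiperiod_even/dyadic_of_window.
apply/eqP; rewrite eqn_leq; apply/andP; split; last first.
  by apply: dvdn_leq; [exact: order_gt0|apply/fix_rotate/iter_order/rotate_inj].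
rewrite leqNgt; apply/negP => lt_order.
have := findex_iter lt_order; rewrite (fix_rotate _).2 // findex0.
by move=> /eqP; rewrite eq_sym expn_eq0.
Qed.

(** All [2 ^ (2 ^ n)] traces fall into orbits of length [2 ^ n.+1]. With [k = n + 1] the count is
    the cardinality of [Z_k]. *)
Lemma card_froots : #|froots rotate| = (2 ^ (2 ^ n - n.+1))%N.
Proof.
have := @fcard_order_set _ _ rotate_inj (2 ^ n.+1)%N predT.
have -> : #|predT : pred Y| = (2 ^ (2 ^ n))%N.
  by rewrite (eq_card (B := {: Y})) // card_ffun card_bool card_ord.
have -> : fcard rotate predT = #|froots rotate|.
  by apply: eq_card => f; rewrite !inE andbT.
move=> cardE; rewrite (expnB (isT : 0 < 2)%N (ltn_expl n (isT : 1 < 2)%N)).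
rewrite -cardE ?mulnK ?expn_gt0 //.
by apply/fintype.subsetP => f _; rewrite inE rotate_order.
Qed.

(** [Zset n.+1] has as many elements as there are orbits; the enumerations of both finite types
    match each index with the canonical root of an orbit. *)
Lemma exists_orbit_representatives : exists rep : Zset n.+1 -> set int,
  [/\ forall a, dyadic n (rep a),
      forall A, dyadic n A -> exists a x, A = translate x (rep a)
    & forall a b x, rep a = translate x (rep b) -> a = b].
Proof.
have cardE : #|{ffun 'I_(2 ^ n.+1.-1 - n.+1) -> bool}| = #|froots rotate|.
  by rewrite card_ffun card_bool card_ord card_froots.
pose root_of (a : Zset n.+1) : Y :=
  enum_val (cast_ord cardE (enum_rank (finfun a))).
have root_inj : injective root_of.
  move=> a b /enum_val_inj/cast_ord_inj/enum_rank_inj /ffunP ab.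
  by apply/funext => i; have := ab i; rewrite !ffunE.
have csym := fconnect_sym rotate_inj.
exists (of_window \o root_of); split=> [a|A nA|a b x /= ab].
- exact: dyadic_of_window.
- have rA : froot rotate (window A) \in froots rotate by exact: roots_root.
  pose z := enum_val (cast_ord (esym cardE)
    (enum_rank_in rA (froot rotate (window A)))).
  pose a : Zset n.+1 := z.
  have aE : root_of a = froot rotate (window A).
    have -> : root_of a = enum_val (cast_ord cardE (enum_rank z)).
      rewrite /root_of (_ : finfun a = z) //.
      by apply/ffunP => i; rewrite ffunE.
    by rewrite enum_valK cast_ordKV enum_rankK_in.
  exists a, (findex rotate (root_of a) (window A))%:Z.
  apply: window_inj => //=; first exact/dyadic_translate/dyadic_of_window.
  by rewrite -iter_rotate iter_findex // aE csym connect_root.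
- pose k := `|(x %% 2 ^+ n.+1)%Z|%N.
  have kE : root_of a = iter k rotate (root_of b).
    rewrite iter_rotate -[LHS]of_windowK ab; congr (window _).
    rewrite gez0_abs ?modz_ge0 ?expf_neq0 // dyadic_mod //.
    exact: dyadic_of_window.
  have rootE c : froot rotate (root_of c) = root_of c.
    by apply/eqP; have := enum_valP (cast_ord cardE (enum_rank (finfun c))).
  apply: root_inj; rewrite -rootE -(rootE b); apply/(fingraph.rootP csym).
  by rewrite csym kE fconnect_iter.
Qed.

End Orbits.

(** * Equivariant coordinates on twin sets *)

Section Coordinates.
Context {R : realType}.
Variable n : nat.
Implicit Types (A B : set int) (x y : int).
Implicit Types (c : croots R (2 ^ n.+1)) (a : Zset n.+1).

Definition rep : Zset n.+1 -> set int :=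
  projT1 (cid (exists_orbit_representatives n)).

Lemma repP : [/\ forall a, dyadic n (rep a),
    forall A, dyadic n A -> exists a x, A = translate x (rep a)
  & forall a b x, rep a = translate x (rep b) -> a = b].
Proof. by rewrite /rep; case: cid. Qed.

Lemma twin_at_rootz A x y : twin_at n A -> translate x A = translate y A ->
  rootz n x = rootz n y :> croots R _.
Proof.
move=> nA xy; apply/rootz_eq; apply: (twin_at_period nA).
by rewrite addrC -translateD xy translateD addNr translate0.
Qed.

Lemma dyadic_rootz A x y : dyadic n A ->
  rootz n x = rootz n y :> croots R _ -> translate x A = translate y A.
Proof.
move=> nA /rootz_eq [q xyE]; rewrite -[x](subrK y) xyE addrC -translateD.
congr (translate _ _); rewrite exprSr -mulrA.
exact: translate_antiperiod_even.
Qed.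

Definition point c a : set int := translate (clog c) (rep a).

Lemma dyadic_point c a : dyadic n (point c a).
Proof. by apply: dyadic_translate; have [+ _ _] := repP; apply. Qed.

Lemma point_rootz x a : point (rootz n x) a = translate x (rep a).
Proof. by have [rD _ _] := repP; apply: dyadic_rootz; rewrite ?clogK. Qed.

Lemma translate_point x c a :
  translate x (point c a) = point (c * rootz n x)%g a.
Proof. by rewrite -{2}(clogK c) -rootzD point_rootz translateD addrC. Qed.

(* Translation invariance of [base] makes the coordinates below equivariant. *)
Definition base A : set int := xget set0
  [set B | (exists x, A = translate x B) /\
           (dyadic n A -> exists a, B = rep a)].

Lemma baseP A : (exists x, A = translate x (base A)) /\
  (dyadic n A -> exists a, base A = rep a).
Proof.
rewrite /base; case: xgetP => [B _ //|noB]; exfalso.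
have [nA|nA] := pselect (dyadic n A); last first.
  by apply: (noB A); split=> //; exists 0; rewrite translate0.
have [_ cover _] := repP; have [a [x AE]] := cover _ nA.
by apply: (noB (rep a)); split; [exists x|exists a].
Qed.

Lemma base_translate x A : base (translate x A) = base A.
Proof.
congr (xget _ _); apply/seteqP; split=> B [[y yE] dyadicB]; split.
- by exists (- x + y); rewrite -translateD -yE translateK.
- by move=> nA; apply/dyadicB/dyadic_translate.
- by exists (x + y); rewrite -translateD -yE.
- move=> nA; apply: dyadicB; rewrite -(translateK x A).
  exact: dyadic_translate.
Qed.

Definition phase A : int := xget 0 [set x | A = translate x (base A)].

Lemma phaseP A : A = translate (phase A) (base A).
Proof. by have /(xgetPex 0) := (baseP A).1. Qed.

Definition orbit_index A : Zset n.+1 :=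
  if pselect (exists a, base A = rep a) is left e then projT1 (cid e)
  else fun=> false.

(** Inverse to [point] on dyadic sets. On the other twin sets of level [n] it is still equivariant,
    with the default orbit index, so [point] after [coord] retracts them onto dyadic sets. *)
Definition coord A : croots R (2 ^ n.+1) * Zset n.+1 :=
  (rootz n (phase A), orbit_index A).

Lemma coord_translate x A : twin_at n A ->
  coord (translate x A) = (((coord A).1 * rootz n x)%g, (coord A).2).
Proof.
move=> nA; rewrite /coord /orbit_index base_translate; congr pair.
rewrite /= -rootzD; apply: (@twin_at_rootz (base A)).
  rewrite -(translateK (phase A) (base A)) -phaseP.
  exact: twin_at_translate.
by rewrite -{1}(base_translate x) -phaseP addrC -translateD -phaseP.
Qed.

Lemma coordK A : dyadic n A -> point (coord A).1 (coord A).2 = A.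
Proof.
move=> nA; rewrite /= point_rootz /orbit_index [RHS]phaseP.
by case: pselect => [e|[]]; [case: cid => a /= <-|exact: (baseP A).2].
Qed.

Lemma pointK c a : coord (point c a) = (c, a).
Proof.
have [rD _ rI] := repP.
have E := coordK (dyadic_point c a); set d := coord _ in E *.
have dE : d.2 = a.
  apply/esym/(rI _ _ (- clog c + clog d.1)).
  by rewrite -translateD -/(point d.1 d.2) E translateK.
rewrite [LHS]surjective_pairing dE; congr pair.
rewrite -(clogK d.1) -(clogK c); apply: (@twin_at_rootz (rep a)).
  exact: dyadic_twin_at.
by rewrite -/(point d.1 a) -/(point c a) -E dE.
Qed.

End Coordinates.

(** * The action of a maximal linked system on sets *)

Definition shifts (l : superextension int) : set int -> set int :=
  translates (set_val l).

Lemma shifts_maximal_linked (l : superextension int) :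
  maximal_linked (set_val l).
Proof. exact: set_valP. Qed.

Lemma shifts_inj (l m : superextension int) : shifts l =1 shifts m -> l = m.
Proof.
move=> lm; apply: val_inj; apply/funext => A.
have := congr1 (fun B : set int => B 0) (lm A).
by rewrite /shifts /translates /= !translate0.
Qed.

Lemma shiftsM (l m : superextension int) A :
  shifts (l * m)%g A = shifts l (shifts m A).
Proof.
apply/funext => x; rewrite /shifts /translates /=; congr (set_val l _).
apply/funext => y; rewrite /translate /=; congr (set_val m _).
by apply/funext => z; rewrite /= addrA.
Qed.

Lemma shifts_translate l x A :
  shifts l (translate x A) = translate x (shifts l A).
Proof.
apply/funext => y; rewrite /shifts /translates /= translateD addrC.
by rewrite /translate.
Qed.

Lemma shiftsC l A : shifts l (~` A) = ~` shifts l A.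
Proof.
have lM := shifts_maximal_linked l.
apply/seteqP; split=> x; rewrite /shifts /translates /= translateC.
  by move=> lC lA; have [y []] := lM.1 _ _ lA lC.
exact: (maximal_linkedC 0 lM).
Qed.

Lemma shiftsT l : shifts l setT = setT.
Proof.
apply/seteqP; split=> // x _.
exact: (maximal_linked_setT 0 (shifts_maximal_linked l)).
Qed.

Lemma shifts0 l : shifts l set0 = set0.
Proof. by rewrite -setCT shiftsC shiftsT setCT. Qed.

Lemma shifts_dyadic l n A : dyadic n A -> dyadic n (shifts l A).
Proof. by move=> nA; rewrite /dyadic -shifts_translate nA shiftsC. Qed.

Definition level (A : set int) : nat := xget 0%N [set n | twin_at n A].

Lemma levelE n A : twin_at n A -> level A = n.
Proof.
move=> nA; have levelP : exists m, [set m | twin_at m A] m by exists n.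
exact: twin_at_inj (xgetPex 0%N levelP) nA.
Qed.

(** * The wreath products acting on dyadic sets *)

Section WreathAction.
Context {R : realType}.

Local Notation C n := (croots R (2 ^ n.+1)).
Local Notation W n := (wreath (C n) (Zset n.+1)).
Local Notation WW := (prod_topology (fun n => discrete_topology (W n))).

(** The equivariant map sending the base point of orbit [a] to [point (w.1 a) (w.2 a)], evaluated at
    the coordinates [p]. *)
Definition act n (w : W n) (p : C n * Zset n.+1) : set int :=
  point (p.1 * w.1 p.2)%g (w.2 p.2).

Lemma act_rootz n (w : W n) x (p : C n * Zset n.+1) :
  act w ((p.1 * rootz n x)%g, p.2) = translate x (act w p).
Proof. by rewrite /act /= translate_point -!mulgA (crootsC (rootz n x)). Qed.

Definition act_on (w : WW) (A : set int) : set int :=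
  act (w (level A)) (coord (level A) A).

Lemma act_onE n (w : WW) A : twin_at n A -> act_on w A = act (w n) (coord n A).
Proof. by rewrite /act_on => /levelE ->. Qed.

Lemma act_on_translate (w : WW) x A :
  twin A -> act_on w (translate x A) = translate x (act_on w A).
Proof.
move=> /twin_level[n nA]; rewrite !(act_onE (n := n)) ?coord_translate //.
  exact: act_rootz.
exact: twin_at_translate.
Qed.

(** Complementing a twin set is translating it by an odd multiple of [2 ^+ n], and on the dyadic
    image of the same level that translation is complementation again. *)
Lemma act_onC (w : WW) A : twin A -> act_on w (~` A) = ~` act_on w A.
Proof.
move=> tA; have [n nA] := twin_level tA; have [q qA] := nA.
rewrite -qA act_on_translate // (act_onE _ nA).
exact/translate_antiperiod_odd/dyadic_point.
Qed.

Definition of_wreath (w : WW) : superextension int :=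
  exist _ (spread (act_on w)) (mem_set (spread_maximal_linked (act_onC w))).

Lemma of_wreath_hub w A : hub A -> shifts (of_wreath w) A = setT.
Proof. exact: translates_spread_hub. Qed.

Lemma of_wreath_hubC w A : hub (~` A) -> shifts (of_wreath w) A = set0.
Proof. exact: translates_spread_hubC. Qed.

Lemma of_wreath_twin w n A : twin_at n A ->
  shifts (of_wreath w) A = act (w n) (coord n A).
Proof.
move=> nA; rewrite -act_onE //; apply: translates_spread_twin.
  exact: act_on_translate.
exact: twin_at_twin nA.
Qed.

Lemma of_wreath_point w n c a :
  shifts (of_wreath w) (point c a) = point (c * (w n).1 a)%g ((w n).2 a).
Proof.
by rewrite (of_wreath_twin _ (dyadic_twin_at (dyadic_point c a))) pointK.
Qed.

(* [of_wreath w] sends every set to [setT], [set0] or a dyadic set. *)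
Lemma mul_of_wreath_ext l m w :
  (forall n (c : C n) a, shifts l (point c a) = shifts m (point c a)) ->
  (l * of_wreath w = m * of_wreath w)%g.
Proof.
move=> lm; apply: shifts_inj => A; rewrite !shiftsM.
have [/twin_level[n nA]|hA|hA] := hub_or_twin A.
- by rewrite (of_wreath_twin _ nA); exact: lm.
- by rewrite of_wreath_hub // !shiftsT.
- by rewrite of_wreath_hubC // !shifts0.
Qed.

Lemma of_wreathM (v w : WW) :
  of_wreath (v * w)%g = (of_wreath v * of_wreath w)%g.
Proof.
apply: shifts_inj => A; rewrite shiftsM.
have [/twin_level[n nA]|hA|hA] := hub_or_twin A.
- rewrite !(of_wreath_twin _ nA) of_wreath_point /act /= -mulgA.
  by rewrite (crootsC ((v n).1 _)).
- by rewrite !(of_wreath_hub _ hA) shiftsT.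
- by rewrite !(of_wreath_hubC _ hA) shifts0.
Qed.

Definition shift_coord (l : superextension int) n (a : Zset n.+1) :
  C n * Zset n.+1 := coord n (shifts l (point (rootz n 0 : C n) a)).

Definition to_wreath (l : superextension int) : WW :=
  fun n => (fun a => (shift_coord l a).1, fun a => (shift_coord l a).2).

Lemma of_wreathK : cancel of_wreath to_wreath.
Proof.
move=> w; apply: functional_extensionality_dep => n.
rewrite /to_wreath [RHS]surjective_pairing; congr pair; apply/funext => a;
by rewrite /shift_coord of_wreath_point rootz0 pointK.
Qed.

(** By equivariance, the action on dyadic sets is determined by the base points of the orbits, whose
    images [to_wreath] records. *)
Lemma shifts_point l n (c : C n) a :
  shifts l (point c a) =
  point (c * (to_wreath l n).1 a)%g ((to_wreath l n).2 a).
Proof.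
rewrite -(clogK c) -{1}(rootz0 (rootz n (clog c))) -translate_point.
rewrite shifts_translate /= crootsC -translate_point coordK //.
exact/shifts_dyadic/dyadic_point.
Qed.

Definition wreath_id : WW := fun n => (fun=> rootz n 0, id).

(** The idempotent [e] of the overview: [wreath_id] moves no dyadic set, so a twin set goes to its
    dyadic retract. *)
Definition retraction : superextension int := of_wreath wreath_id.

(** The right side absorbs [retraction], so it suffices to compare the left factors on dyadic sets,
    where [l] acts as [to_wreath l]. *)
Lemma mul_retraction l : (l * retraction)%g = of_wreath (to_wreath l).
Proof.
have -> : of_wreath (to_wreath l) = (of_wreath (to_wreath l) * retraction)%g.
  rewrite -of_wreathM; congr of_wreath.
  apply: functional_extensionality_dep => n.
  rewrite [LHS]surjective_pairing; congr pair; apply/funext => a /=.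
  by rewrite crootsC rootz0.
by apply: mul_of_wreath_ext => n c a; rewrite of_wreath_point -shifts_point.
Qed.

Lemma of_wreath_retraction w : (of_wreath w * retraction)%g = of_wreath w.
Proof. by rewrite mul_retraction of_wreathK. Qed.

End WreathAction.

(** * Topology *)

Lemma continuous_prod_topology {X : topologicalType} {I : Type}
    {T : I -> topologicalType} (f : X -> prod_topology T) :
  (forall i, continuous (fun x => f x i)) -> continuous f.
Proof.
move=> fc x; apply/cvg_sup => i.
exact: (@continuous_comp_initial _ X (T i) (fun g : prod_topology T => g i)
  f (fc i)).
Qed.

Lemma prod_topology_proj_continuous {I : Type} {T : I -> topologicalType} i :
  continuous (fun g : prod_topology T => g i).
Proof.
move=> g; have /cvg_sup/(_ i) gi : g --> g by exact: cvg_id.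
exact: cvg_comp gi (@initial_continuous _ _ (fun g : prod_topology T => g i) g).
Qed.

Lemma continuous_discrete {X : topologicalType} {D : discreteTopologicalType}
    (f : X -> D) :
  (forall x, \forall y \near x, f y = f x) -> continuous f.
Proof.
move=> floc x U; rewrite nbhs_simpl nbhs_principalE => /principal_filterP Ux.
by apply: filterS (floc x) => y /= ->.
Qed.

Lemma near_discrete {X : topologicalType} {D : discreteTopologicalType}
    (f : X -> D) x :
  {for x, continuous f} -> \forall y \near x, f y = f x.
Proof.
move=> fc; have := fc [set f x]; rewrite nbhs_principalE.
by apply; exact/principal_filterP.
Qed.

Lemma continuous_superextension {X : topologicalType}
    (f : X -> superextension int) :
  (forall A x, \forall y \near x, set_val (f y) A = set_val (f x) A) ->
  continuous f.
Proof.
move=> floc; apply: continuous_comp_initial.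
apply: continuous_prod_topology => A; apply: continuous_discrete => x.
by apply: filterS (floc A x) => y; rewrite /= /indicator => ->.
Qed.

Lemma near_superextension (l : superextension int) A :
  \forall m \near l, set_val m A = set_val l A.
Proof.
have /(near_discrete (f := fun m : superextension int => indicator m A)) :
    {for l, continuous (fun m => indicator m A)}.
  apply: (@continuous_comp _ _ _ (@indicator int)
    (fun g : prod_topology (fun=> bool) => g A)).
    exact: initial_continuous.
  exact: prod_topology_proj_continuous.
apply: filterS => m; rewrite /indicator => E.
by apply/propext; split=> /asboolP; [rewrite E|rewrite -E] => /asboolP.
Qed.

(** A dyadic set has only finitely many translates, so finitely many membership conditions control
    the whole image. *)
Lemma near_shifts (l : superextension int) n A : dyadic n A ->
  \forall m \near l, shifts m A = shifts l A.
Proof.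
move=> nA; pose agree (i : 'I_(2 ^ n.+1)) (m : superextension int) :=
  set_val m (translate i%:Z A) = set_val l (translate i%:Z A).
have : \forall m \near l, forall i, agree i m.
  apply: (@filter_forall _ _ agree (nbhs l)) => i.
  exact: near_superextension.
apply: filterS => m mE; apply/funext => x; rewrite /shifts /translates /=.
have -> : translate x A = translate `|(x %% 2 ^+ n.+1)%Z|%N A.
  by rewrite gez0_abs ?modz_ge0 ?expf_neq0 // dyadic_mod.
have rlt : (`|(x %% 2 ^+ n.+1)%Z| < 2 ^ n.+1)%N.
  have D0 : (0 : int) < 2 ^+ n.+1 by rewrite exprn_gt0.
  by rewrite -ltz_nat gez0_abs ?modz_ge0 ?gt_eqF // -natz natrX ltz_pmod.
exact: (mE (Ordinal rlt)).
Qed.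

Lemma embedding_isomorphic (S T : tsemigroupType) (f : T -> S) :
  {morph f : x y / (x * y)%g} -> injective f -> continuous f ->
  (forall x U, nbhs x U -> \forall s \near f x, forall y, f y = s -> U y) ->
  topologically_isomorphic T (range f).
Proof.
move=> fM fI fC fO.
have fR x : f x \in range f by apply/mem_set; exists x.
have /choice [g gE] : forall a : range f, exists x, f x = set_val a.
  by move=> a; have [x _ xa] := set_valP a; exists x.
exists (fun x => exist _ (f x) (fR x)), g; split=> //.
- by move=> x; apply: fI; rewrite gE.
- by move=> a; apply: val_inj; rewrite /= gE.
- exact: (@continuous_comp_initial _ _ _ (@set_val S (range f))
    (fun x => exist _ (f x) (fR x)) fC).
move=> a U; rewrite nbhs_simpl => /fO; rewrite gE => fU.
have : nbhs a (set_val @^-1` [set s | forall y, f y = s -> U y]).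
  exact: (@initial_continuous _ _ (@set_val S (range f)) a _ fU).
by apply: filterS => b /= bU; apply: bU; rewrite gE.
Qed.

Lemma split_embedding_isomorphic (S T : tsemigroupType)
    (f : T -> S) (g : S -> T) :
  {morph f : x y / (x * y)%g} -> cancel f g -> continuous f -> continuous g ->
  topologically_isomorphic T (range f).
Proof.
move=> fM fK fC gC; apply: embedding_isomorphic => //; first exact: can_inj fK.
move=> x U Ux; have : \forall s \near f x, U (g s) by apply: gC; rewrite fK.
by apply: filterS => s /= Us y ys; rewrite -(fK y) ys.
Qed.

(** * Ideals and groups *)

Lemma superextension_mulr_continuous (e : superextension int) :
  continuous (fun l : superextension int => (l * e)%g).
Proof.
apply: continuous_superextension => A l.
exact: (near_superextension l (shifts e A)).
Qed.

Section Ideals.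
Context {R : realType}.

Local Notation C n := (croots R (2 ^ n.+1)).
Local Notation W n := (wreath (C n) (Zset n.+1)).
Local Notation WW := (prod_topology (fun n => discrete_topology (W n))).
Local Notation CC := (prod_topology (fun n => discrete_topology (C n))).
Local Notation ZZ := (forall n, Zset n.+1).

Lemma of_wreath_continuous : continuous (of_wreath : WW -> superextension int).
Proof.
apply: continuous_superextension => A w.
have : nbhs w [set v : WW | v (level A) = w (level A)].
  apply: (@near_discrete _ (discrete_topology (W (level A)))
    (fun v : WW => v (level A))).
  exact: prod_topology_proj_continuous.
by apply: filterS => v vw; rewrite !set_valE /= /spread /= /act_on vw.
Qed.

Lemma near_shift_coord l n (a : Zset n.+1) :
  \forall m \near l, shift_coord m a = shift_coord l a :> C n * _.
Proof.
have : \forall m \near l, shifts m (point (rootz n 0 : C n) a) =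
    shifts l (point (rootz n 0 : C n) a).
  exact/near_shifts/dyadic_point.
by apply: filterS => m; rewrite /shift_coord => ->.
Qed.

Lemma to_wreath_continuous : continuous (to_wreath : superextension int -> WW).
Proof.
apply: continuous_prod_topology => n; apply: continuous_discrete => l.
pose agree (f : {ffun 'I_(2 ^ n.+1.-1 - n.+1) -> bool})
    (m : superextension int) :=
  shift_coord m (f : Zset n.+1) = shift_coord l (f : Zset n.+1) :> C n * _.
have : \forall m \near l, forall f, agree f m.
  by apply: (@filter_forall _ _ agree (nbhs l)) => f; exact: near_shift_coord.
apply: filterS => m ml; rewrite /to_wreath.
have ffE (a : Zset n.+1) : a = finfun a by apply/funext => i; rewrite ffunE.
by congr pair; apply/funext => a; rewrite [a]ffE ml.
Qed.

Lemma principal_retraction :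
  principal_left_ideal (retraction (R := R)) = range (of_wreath : WW -> _).
Proof.
apply/seteqP; split=> [_ [l _ <-]|_ [w _ <-]].
  by rewrite mul_retraction; exists (to_wreath l).
by exists (of_wreath w) => //; exact: of_wreath_retraction.
Qed.

Lemma principal_retraction_isomorphic :
  topologically_isomorphic WW (principal_left_ideal (retraction (R := R))).
Proof.
rewrite principal_retraction.
apply: (@split_embedding_isomorphic _ _ _ to_wreath).
- exact: of_wreathM.
- exact: of_wreathK.
- exact: of_wreath_continuous.
- exact: to_wreath_continuous.
Qed.

(** * Retractions onto one orbit of each level *)

Definition cinv n (c : C n) : C n := rootz n (- clog c).

Lemma cmulV n (c : C n) : (c * cinv c)%g = rootz n 0.
Proof. by rewrite -{1}(clogK c) -rootzD subrr. Qed.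

Lemma cmulKV n (c d : C n) : (c * d * cinv d)%g = c.
Proof. by rewrite -mulgA cmulV crootsC rootz0. Qed.

Lemma cmulVK n (c d : C n) : (c * cinv d * d)%g = c.
Proof. by rewrite -mulgA (crootsC _ d) cmulV crootsC rootz0. Qed.

(* [e] retracts the dyadic sets of each level [n] onto the orbit of
   [point 1 (b n)]. *)
Definition orbit_retraction (e : superextension int) (b : ZZ) :=
  [/\ forall A, [\/ shifts e A = set0, shifts e A = setT |
        exists n (c : C n), shifts e A = point c (b n)],
      forall n a, ((to_wreath e : WW) n).2 a = b n
    & forall n (c : C n), shifts e (point c (b n)) = point c (b n)].

(** All values of [e] are [set0], [setT] or translates of the base points of the orbits [b n], so a
    left factor matters only through its action on those points. *)
Lemma orbit_retraction_ext e b l m : orbit_retraction e b ->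
  (forall n, shifts l (point (rootz n 0 : C n) (b n)) =
             shifts m (point (rootz n 0 : C n) (b n))) ->
  (l * e = m * e)%g.
Proof.
move=> [eI _ _] lm; apply: shifts_inj => A; rewrite !shiftsM.
case: (eI A) => [->|->|[n [c ->]]]; rewrite ?shifts0 ?shiftsT //.
have -> : c = (rootz n 0 * rootz n (clog c))%g by rewrite rootz0 clogK.
by rewrite -translate_point [LHS]shifts_translate lm -shifts_translate.
Qed.

Definition const_wreath (c : CC) (b : ZZ) : WW :=
  fun n => (fun=> c n, fun=> b n).

(** Any element [x] of [L], followed by a map onto one orbit per level, stays in [L] and generates
    it by minimality. *)
Lemma minimal_left_ideal_retraction L : minimal_left_ideal L ->
  exists e b, orbit_retraction e b /\ L = principal_left_ideal e.
Proof.
move=> [[[x Lx] Lmul] Lmin].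
pose b : ZZ := fun=> (fun=> false).
(* This phase undoes the one that [x] adds on the orbit [b n], so that [e] fixes this orbit
   pointwise. *)
pose d : CC := fun n => cinv (((to_wreath x : WW) n).1 (b n)).
pose e := (of_wreath (const_wreath d b) * x)%g; exists e, b; split; last first.
  apply/esym/Lmin.
    split=> [|s _ [t _ <-]]; first by exists (e * e)%g, e.
    by exists (s * t)%g => //; exact/esym/mulgA.
  by move=> _ [s _ <-]; apply/Lmul/Lmul.
have eE n (c : C n) a : shifts e (point c a) =
    point (c * ((to_wreath x : WW) n).1 a * d n)%g (b n).
  by rewrite shiftsM (shifts_point x c) of_wreath_point.
split=> [A|n a|n c].
- rewrite shiftsM; have [/twin_level[n nA]|hA|hA] := hub_or_twin (shifts x A).
  + by apply: Or33; rewrite (of_wreath_twin _ nA); eexists _, _; reflexivity.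
  + by apply: Or32; rewrite of_wreath_hub.
  + by apply: Or31; rewrite of_wreath_hubC.
- by rewrite -[LHS]/(shift_coord e a).2 /shift_coord eE pointK.
- by rewrite eE cmulKV.
Qed.


(** Rotates every orbit of level [n] by [c n]; the products with an orbit retraction on the right
    form the maximal group of that idempotent. *)
Definition rotation (c : CC) : WW := fun n => (fun=> c n, id).

Lemma orbit_retraction_rotation e b : orbit_retraction e b -> forall c n,
  shifts (of_wreath (rotation c) * e)%g (point (rootz n 0 : C n) (b n)) =
  point (c n) (b n).
Proof. by move=> [_ _ eK] c n; rewrite shiftsM eK of_wreath_point rootz0. Qed.

Lemma rotation_continuous : continuous rotation.
Proof.
apply: continuous_prod_topology => n; apply: continuous_discrete => c.
have : nbhs c [set d : CC | d n = c n].
  apply: (@near_discrete _ (discrete_topology (C n)) (fun d : CC => d n)).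
  exact: prod_topology_proj_continuous.
by apply: filterS => d; rewrite /rotation /= => ->.
Qed.

Lemma shift_coord_continuous b : continuous
  (fun l => (fun n => (shift_coord l (b n)).1) : CC).
Proof.
apply: continuous_prod_topology => n; apply: continuous_discrete => l.
by apply: filterS (near_shift_coord l (b n)) => m ->.
Qed.

Lemma rotation_mul e b : orbit_retraction e b ->
  {morph (fun c => of_wreath (rotation c) * e)%g : c d / (c * d)%g}.
Proof.
move=> eb c d; have [_ _ eK] := eb.
rewrite mulgA; apply: (orbit_retraction_ext eb) => n.
rewrite [RHS]shiftsM !of_wreath_point [RHS]shiftsM eK of_wreath_point !rootz0.
by congr point; exact: crootsC.
Qed.

Lemma rotation_isomorphic e b : orbit_retraction e b ->
  topologically_isomorphic CC (range (fun c => of_wreath (rotation c) * e)%g).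
Proof.
move=> eb; have eE := orbit_retraction_rotation eb.
apply: (@split_embedding_isomorphic _ CC _
  (fun l n => (shift_coord l (b n)).1)).
- exact: rotation_mul eb.
- move=> c; apply: functional_extensionality_dep => n.
  by rewrite /shift_coord eE pointK.
- move=> c; apply: (@continuous_comp _ _ _ (of_wreath \o rotation)
    (fun l => l * e)%g).
    apply: continuous_comp; first exact: rotation_continuous.
    exact: of_wreath_continuous.
  exact: superextension_mulr_continuous.
- exact: shift_coord_continuous.
Qed.

Lemma rotation_group e b : orbit_retraction e b ->
  group_with_unit (range (fun c => of_wreath (rotation c) * e)%g) e.
Proof.
move=> eb; have fM := rotation_mul eb; have [_ _ eK] := eb.
have ee : (e * e = e)%g.
  apply: shifts_inj => A; rewrite shiftsM; have [eI _ _] := eb.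
  by case: (eI A) => [->|->|[n [c ->]]]; rewrite ?shifts0 ?shiftsT.
pose u : CC := fun n => rootz n 0.
have uE : (of_wreath (rotation u) * e = e)%g.
  rewrite -[RHS]ee; apply: (orbit_retraction_ext eb) => n.
  by rewrite of_wreath_point rootz0 eK.
split.
- by exists u.
- by move=> _ _ [c _ <-] [d _ <-]; exists (c * d)%g.
- move=> _ [c _ <-]; split; last by rewrite -mulgA ee.
  rewrite -{1}uE -fM; congr (of_wreath (rotation _) * e)%g.
  by apply: functional_extensionality_dep => n; exact: rootz0.
move=> _ [c _ <-]; pose d : CC := fun n => cinv (c n).
exists (of_wreath (rotation d) * e)%g; first by exists d.
split; rewrite -fM -[RHS]uE; congr (of_wreath (rotation _) * e)%g;
  apply: functional_extensionality_dep => n; first exact: cmulV.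
by rewrite -[LHS]/(cinv (c n) * c n)%g crootsC cmulV.
Qed.

Lemma minimal_ideal_idempotent K e : minimal_ideal K -> K e -> (e * e = e)%g ->
  exists b, orbit_retraction e b.
Proof.
move=> [_ Kmin] Ke ee.
(* The minimal ideal lies in the ideal [J] of multiples of [o], which collapses each level onto one
   orbit; hence [e] does so too. *)
pose o : WW := const_wreath (fun n => rootz n 0) (fun=> (fun=> false)).
pose J := [set x | exists p, x = (p.1 * of_wreath o * p.2)%g].
have [|[l m] /= eE] := Kmin J _ e Ke.
  split=> [|s _ [[l m] ->]].
    by exists (of_wreath o * of_wreath o * of_wreath o)%g;
      exists (of_wreath o, of_wreath o).
  by split; [exists (s * l, m)%g|exists (l, m * s)%g]; rewrite /= !mulgA.
pose b : ZZ := fun n => ((to_wreath l : WW) n).2 (fun=> false).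
have oE n (c : C n) a : shifts (l * of_wreath o)%g (point c a) =
    point (c * ((to_wreath l : WW) n).1 (fun=> false))%g (b n).
  rewrite shiftsM of_wreath_point shifts_point crootsC (crootsC c) rootz0.
  by rewrite crootsC.
have eI n a : ((to_wreath e : WW) n).2 a = b n.
  rewrite -[LHS]/(shift_coord e a).2 /shift_coord eE.
  by rewrite [shifts (_ * m)%g _]shiftsM shifts_point oE pointK.
exists b; split=> [A|n a|n c].
- rewrite eE -mulgA shiftsM shiftsM.
  have [/twin_level[n nA]|hA|hA] := hub_or_twin (shifts m A).
  + apply: Or33; rewrite (of_wreath_twin _ nA) shifts_point; eexists _, _.
    reflexivity.
  + by apply: Or32; rewrite of_wreath_hub // shiftsT.
  + by apply: Or31; rewrite of_wreath_hubC // shifts0.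
- exact: eI.
(* The phase [h] added on the orbit [b n] is idempotent in a group, hence trivial. *)
- pose h := ((to_wreath e : WW) n).1 (b n).
  have eP (d : C n) : shifts e (point d (b n)) = point (d * h)%g (b n).
    by rewrite shifts_point eI.
  have hh : (h * h)%g = h.
    have : coord n (shifts (e * e)%g (point h (b n))) =
        coord n (shifts e (point h (b n))) :> C n * _ by rewrite ee.
    rewrite shiftsM !eP !pointK.
    move=> /(congr1 fst)/(congr1 (fun d => d * cinv h)%g).
    by rewrite !cmulKV.
  by rewrite eP -[X in (c * X)%g](cmulKV _ h) hh cmulV crootsC rootz0.
Qed.

Lemma maximal_group_isomorphic (K G : set (superextension int)) :
  minimal_ideal K -> maximal_group K G ->
  topologically_isomorphic CC G.
Proof.
move=> Kmin [e [Ke ee [[u [Gu _ uK Ginv]] GK Ge] Gmax]].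
have {u Gu uK Ginv} eK x : G x -> (e * x = x /\ x * e = x)%g.
  suff -> : e = u by exact: uK.
  have [y Gy [ey _]] := Ginv _ Ge.
  by rewrite -{1}(uK _ Ge).2 -ey mulgA ee.
have [b eb] := minimal_ideal_idempotent Kmin Ke ee.
suff -> : G = range (fun c => of_wreath (rotation c) * e)%g.
  exact: rotation_isomorphic eb.
apply/seteqP; split=> [l Gl|]; last first.
  have eG := rotation_group eb.
  apply: Gmax; [by exists e| |by have [] := eG].
  move=> _ [c _ <-]; have [[_ Kideal] _] := Kmin.
  exact: (Kideal (of_wreath (rotation c)) e Ke).1.
(* As [l = e * l], the orbit [b n] is mapped to itself, and the rotation induced there determines
   [l = l * e]. *)
have [el le] := eK l Gl; pose c : CC := fun n => (shift_coord l (b n)).1.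
exists c => //; rewrite -[RHS]le; apply: (orbit_retraction_ext eb) => n.
have [_ eI _] := eb; rewrite of_wreath_point rootz0.
rewrite -[X in X = _]/(point (shift_coord l (b n)).1 (b n)) /shift_coord.
rewrite -el shiftsM.
by rewrite (shifts_point l) (shifts_point e) eI pointK.
Qed.

(** * The Cantor cube as the product of the orbit index sets *)

Lemma Zset_code : exists (code : {n & 'I_(2 ^ n.+1.-1 - n.+1)} -> nat) decode,
  cancel code decode /\ cancel decode code.
Proof.
pose I : countType := {n & 'I_(2 ^ n.+1.-1 - n.+1)}%type.
(* The exponents of levels 0 and 1 are zero; from level 2 on they are positive, so the disjoint
   union is infinite. *)
have i0P n : (0 < 2 ^ n.+3.-1 - n.+3)%N.
  by rewrite subn_gt0 !expnS; have := ltn_expl n (isT : 1 < 2)%N; lia.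
have infI : infinite_set [set: I].
  move=> /(finite_preimage (f := fun n => Tagged _ (Ordinal (i0P n)) : I)).
  rewrite preimage_setT => fin; apply: infinite_nat; apply: fin.
  by move=> m n _ _ /(congr1 tag)[].
have /pcard_eqP[code] := eq_card_nat (countableP _) infI.
have : bijective code by rewrite -setTT_bijective; exact: bij.
by move=> [decode]; exists code, decode.
Qed.

Local Notation TT := (left_zero_semigroup cantor_space * CC)%type.

Definition decode_cantor (code : {n & 'I_(2 ^ n.+1.-1 - n.+1)} -> nat)
    (s : cantor_space) : ZZ :=
  fun n i => s (code (Tagged (fun n => 'I_(2 ^ n.+1.-1 - n.+1)) i)).
Arguments decode_cantor : clear implicits.

Definition encode_cantor (decode : nat -> {n & 'I_(2 ^ n.+1.-1 - n.+1)})
    (z : ZZ) : cantor_space :=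
  fun j => z (tag (decode j)) (tagged (decode j)).

Lemma encode_cantorK code decode :
  cancel code decode -> cancel (encode_cantor decode) (decode_cantor code).
Proof.
move=> codeK z; apply: functional_extensionality_dep => n; apply/funext => i.
by rewrite /decode_cantor /encode_cantor codeK.
Qed.

Lemma decode_cantorK code decode :
  cancel decode code -> cancel (decode_cantor code) (encode_cantor decode).
Proof.
move=> decodeK s; apply/funext => j.
rewrite -{2}(decodeK j) /decode_cantor /encode_cantor.
by case: (decode j).
Qed.

Lemma near_decode_cantor code s n :
  \forall t \near s, decode_cantor code t n = decode_cantor code s n.
Proof.
pose agree (i : 'I_(2 ^ n.+1.-1 - n.+1)) (t : cantor_space) :=
  decode_cantor code t n i = decode_cantor code s n i.
have : \forall t \near s, forall i, agree i t.
  apply: (@filter_forall _ _ agree (nbhs s)) => i.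
  have kC := @prod_topology_proj_continuous nat (fun=> bool)
    (code (Tagged (fun n => 'I_(2 ^ n.+1.-1 - n.+1)) i)) s.
  exact: (@near_discrete cantor_space bool _ _ kC).
by apply: filterS => t ts; apply/funext.
Qed.

(** An element of the ideal is determined by the images of the base points of the orbits [b n]:
    their orbits give the Cantor factor, their phases the group factor. *)
Lemma minimal_left_ideal_isomorphic (L : set (superextension int)) :
  minimal_left_ideal L -> topologically_isomorphic TT L.
Proof.
move=> /minimal_left_ideal_retraction [e [b [eb ->]]].
have [code [decode [codeK decodeK]]] := Zset_code.
pose h n a := ((to_wreath e : WW) n).1 a.
pose dec := decode_cantor code; pose enc := encode_cantor decode.
(* Dividing by [h] cancels the phase that [e] adds when it brings the right factor's orbit back to
   [b n]; so phases multiply and the left factor's orbit survives. *)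
pose w (p : TT) : WW :=
  const_wreath (fun n => p.2 n * cinv (h n (dec p.1 n)))%g (dec p.1).
pose q (l : superextension int) n : C n * Zset n.+1 := shift_coord l (b n).
pose f p := (of_wreath (w p) * e)%g.
pose g l : TT :=
  (enc (fun n => (q l n).2), fun n => ((q l n).1 * h n (q l n).2)%g).
have [_ eI eK] := eb.
have fE p n : shifts (f p) (point (rootz n 0 : C n) (b n)) =
    point (p.2 n * cinv (h n (dec p.1 n)))%g (dec p.1 n).
  by rewrite shiftsM eK of_wreath_point rootz0.
have qf p n : q (f p) n = (p.2 n * cinv (h n (dec p.1 n)), dec p.1 n)%g.
  by rewrite /q /shift_coord fE pointK.
suff -> : principal_left_ideal e = range f.
  apply: (@split_embedding_isomorphic _ TT f g).
  - move=> p p'; rewrite [RHS]mulgA; apply: (orbit_retraction_ext eb) => n.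
    rewrite [RHS]shiftsM !of_wreath_point [RHS]shiftsM (shifts_point e).
    rewrite (eI n) of_wreath_point !rootz0; congr point.
    by rewrite cmulVK mulgA (crootsC (p'.2 n)).
  - move=> p; rewrite [RHS]surjective_pairing /g; congr pair.
      by rewrite -[RHS](decode_cantorK decodeK); congr enc;
        apply: functional_extensionality_dep => n; rewrite qf.
    by apply: functional_extensionality_dep => n; rewrite qf cmulVK.
  - move=> p; apply: (@continuous_comp _ _ _ (of_wreath \o w)
      (fun l => l * e)%g).
      apply: continuous_comp; last exact: of_wreath_continuous.
      apply: continuous_prod_topology => n; apply: continuous_discrete => {}p.
      have near1 : \forall p' \near p, dec p'.1 n = dec p.1 n.
        exact: (cvg_fst (near_decode_cantor code p.1 n)).
      have near2 : \forall p' \near p, p'.2 n = p.2 n.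
        apply: (@near_discrete _ (discrete_topology (C n))
          (fun p' : TT => p'.2 n)).
        apply: (@continuous_comp _ _ _ snd (fun c : CC => c n)).
          exact: cvg_snd.
        exact: prod_topology_proj_continuous.
      apply: filterS2 near1 near2 => p' E1 E2.
      by rewrite /w /const_wreath E1 E2.
    exact: superextension_mulr_continuous.
  - have g1C : continuous (fun l => (g l).1).
      apply: (@continuous_prod_topology _ nat (fun=> bool)) => j.
      apply: continuous_discrete => l.
      apply: filterS (near_shift_coord l (b (tag (decode j)))) => m ml.
      exact: (congr1 (fun x => x.2 (tagged (decode j))) ml).
    have g2C : continuous (fun l => (g l).2).
      apply: continuous_prod_topology => n; apply: continuous_discrete => l.
      apply: filterS (near_shift_coord l (b n)) => m ml.
      exact: (congr1 (fun x => (x.1 * h n x.2)%g) ml).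
    by move=> l; exact: cvg_pair (g1C l) (g2C l).
apply/seteqP; split=> [_ [l _ <-]|_ [p _ <-]]; last by exists (of_wreath (w p)).
exists (g (l * e)%g) => //; apply: (orbit_retraction_ext eb) => n.
have decE z : dec (enc z) = z := encode_cantorK codeK z.
rewrite of_wreath_point rootz0; set l' := (l * e)%g.
rewrite -[LHS]/(point ((q l' n).1 * h n (q l' n).2 *
  cinv (h n (dec (enc (fun n => (q l' n).2)) n)))%g
  (dec (enc (fun n => (q l' n).2)) n)) decE cmulKV.
by rewrite coordK shiftsM eK //; exact/shifts_dyadic/dyadic_point.
Qed.

End Ideals.

(** * Profinite semigroups *)

Section FiniteSemigroups.
Context {R : realType}.

Local Notation C n := (croots R (2 ^ n.+1)).
Local Notation W n := (wreath (C n) (Zset n.+1)).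
Local Notation WW := (prod_topology (fun n => discrete_topology (W n))).

(* Cayley's embedding of [S] into the self-maps of [S] with a unit adjoined. *)
Lemma finite_semigroup_wreath (S : semigroupType) : finite_set [set: S] ->
  exists k, forall n, (k <= n)%N -> exists J : S -> W n,
    {morph J : s t / (s * t)%g} /\ injective J.
Proof.
move=> /finite_setP[k /pcard_eqP[f]].
have fI : injective f.
  by move=> s t; apply: ('inj_f : {in setT &, injective f}); rewrite inE.
have fk s : (f s < k)%N by have /(_ s I) := 'funS_f.
(* For [n >= 3] one has [2 * n.+1 <= 2 ^ n], which leaves room for the [k + 1] codes, one of them
   for the adjoined unit. *)
exists k.+3 => n kn; have km : (k < 2 ^ n.+1.-1 - n.+1)%N.
  rewrite ltn_subRL /=.
  have : (2 * n.+1 <= 2 ^ n)%N.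
    have : (3 <= n)%N by lia.
    elim: (n) => // m IHm; rewrite leq_eqVlt => /predU1P[<- //|].
    by move=> /IHm; rewrite expnS; lia.
  lia.
pose num (o : option S) : nat := if o is Some s then f s else k.
have numI : injective num.
  move=> [s|] [t|] //= E; first by rewrite (fI _ _ E).
    by have := fk s; rewrite E ltnn.
  by have := fk t; rewrite -E ltnn.
have num_lt o : (num o < 2 ^ n.+1.-1 - n.+1)%N.
  by case: o => //= s; exact: ltn_trans (fk s) km.
pose ind (o : option S) : Zset n.+1 := fun i => val i == num o.
have indI : injective ind.
  move=> o o' /(congr1 (fun z => z (Ordinal (num_lt o)))).
  by rewrite /ind /= eqxx => /esym/eqP/numI.
pose lmul s (o : option S) := Some (if o is Some t then (s * t)%g else s).
(* Points that code nothing are fixed by every [J s], which keeps [J] multiplicative there. *)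
pose J s (z : Zset n.+1) : Zset n.+1 :=
  if pselect (exists o, ind o = z) is left e then ind (lmul s (projT1 (cid e)))
  else z.
have J_ind s o : J s (ind o) = ind (lmul s o).
  rewrite /J; case: pselect => [e|[]]; last by exists o.
  by case: cid => o' /= /indI ->.
exists (fun s => (fun=> rootz n 0, J s)); split=> [s t|s t].
  congr pair; first by apply/funext => z; rewrite /= rootz0.
  apply/funext => z /=; have [[o <-]|nz] := pselect (exists o, ind o = z).
    by rewrite !J_ind; congr ind; case: o => [u|] //; rewrite /lmul mulgA.
  have Jz u : J u z = z by rewrite /J; case: pselect.
  by rewrite !Jz.
move=> /(congr1 (fun w : W n => w.2 (ind None))) /=.
by rewrite !J_ind => /indI[].
Qed.

End FiniteSemigroups.

(** * Projections of a profinite semigroup *)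

Section Profinite.
Context {T : tsemigroupType} {d : Order.disp_t} {I : porderType d}.
Variables (S : inverse_system I).
Variables (f : T -> projective_limit S) (g : projective_limit S -> T).
Hypotheses (fK : cancel f g) (fM : {morph set_val \o f : x y / (x * y)%g}).
Hypotheses (fC : continuous f) (gC : continuous g).
Hypothesis I_inh : inhabited I.
Hypothesis I_dir : forall i j : I, exists2 k, (i <= k)%O & (j <= k)%O.

Definition limit_proj i (x : T) : S i := set_val (f x) i.

Lemma limit_projM i : {morph limit_proj i : x y / (x * y)%g}.
Proof. by move=> x y; have := congr1 (fun z => z i) (fM x y). Qed.

Lemma limit_proj_bond i j (ij : (i <= j)%O) x :
  bond ij (limit_proj j x) = limit_proj i x.
Proof. exact: (set_valP (f x)). Qed.

Lemma limit_proj_inj x y : (forall i, limit_proj i x = limit_proj i y) -> x = y.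
Proof.
move=> xy; apply: (can_inj fK); apply: val_inj.
by apply: functional_extensionality_dep => i; exact: xy.
Qed.

Lemma near_limit_proj i x : \forall y \near x, limit_proj i y = limit_proj i x.
Proof.
apply: (@near_discrete _ (discrete_topology (S i)) (limit_proj i)).
apply: (@continuous_comp _ _ _ f (fun z => set_val z i)); first exact: fC.
apply: (@continuous_comp _ _ _ (@set_val _ (projective_limit S))
  (fun z : prod_topology (fun i => discrete_topology (S i)) => z i)).
  exact: initial_continuous.
exact: prod_topology_proj_continuous.
Qed.

(** Directedness makes the fibres through [x] a filter base; its image converges to [f x]
    coordinatewise, and continuity of [g] carries this back to [T]. *)
Lemma nbhs_limit_proj x U : nbhs x U ->
  exists i, forall y, limit_proj i y = limit_proj i x -> U y.
Proof.
move=> Ux.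
pose F : set_system T :=
  [set V | exists i, forall y, limit_proj i y = limit_proj i x -> V y].
have FF : Filter F.
  split; first by case: I_inh => i; exists i.
    move=> V V' [i iV] [j jV']; have [k ik jk] := I_dir i j; exists k => y yx.
    by split; [apply: iV; rewrite -!(limit_proj_bond ik) yx|
               apply: jV'; rewrite -!(limit_proj_bond jk) yx].
  by move=> V V' VV' [i iV]; exists i => y /iV /VV'.
have vF : set_val \o f @ F --> set_val (f x).
  apply/cvg_sup => i A [_ [[V oV <-] Vx VA]].
  by exists i => y yx; apply: VA; rewrite /= -/(limit_proj i y) yx.
have fF : f @ F --> f x.
  move=> A [_ [[V oV <-] Vx VA]].
  have [|i iV] := vF V; first exact: open_nbhs_nbhs.
  by exists i => y /iV Vy; exact: VA.
have gU : nbhs (f x) (g @^-1` U) by apply: gC; rewrite fK.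
by have [i iU] := fF _ gU; exists i => y /iU; rewrite /= fK.
Qed.

End Profinite.

(** Second countability leaves countably many pairs of basic sets; for each pair, one projection
    with a fibre between the two is kept if there is any. *)
Lemma profinite_proj_sequence (T : tsemigroupType) :
  profinite T -> @second_countable T ->
  exists (S : nat -> semigroupType) (p : forall m, T -> S m),
  [/\ forall m, finite_set [set: S m],
      forall m, {morph p m : x y / (x * y)%g},
      forall m x, \forall y \near x, p m y = p m x,
      forall x U, nbhs x U -> exists m, forall y, p m y = p m x -> U y
    & forall x y, (forall m, p m x = p m y) -> x = y].
Proof.
move=> [d [I [S [I_inh I_dir Sfin [f [g [fK _ fM fC gC]]]]]]].
move=> [B Bcount [Bopen Bbase]].
have [i0] := I_inh.
have /pcard_injP[code codeI] := Bcount.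
pose q i x := limit_proj f i x.
pose separates k i := exists V U s,
  [/\ B V, B U, pickle (code V, code U) = k,
      forall y, V y -> q i y = s & forall y, q i y = s -> U y].
pose sel k :=
  if pselect (exists i, separates k i) is left e then projT1 (cid e) else i0.
have selP k i : separates k i -> separates k (sel k).
  by move=> ki; rewrite /sel; case: pselect => [e|[]]; [case: cid|exists i].
have qU x U : nbhs x U -> exists k, forall y, q (sel k) y = q (sel k) x -> U y.
  move=> /Bbase [U' [BU' U'x] U'U].
  have /(nbhs_limit_proj fK gC I_inh I_dir) [i iU'] : nbhs x U'.
    by apply: open_nbhs_nbhs; split=> //; exact: Bopen.
  have /Bbase [V [BV Vx] Vi] := near_limit_proj fC i x.
  have [|V' [U1 [s [BV' BU1 kE Vs sU]]]] := selP (pickle (code V, code U')) i.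
    by exists V, U', (q i x).
  exists (pickle (code V, code U')) => y yx; apply: U'U.
  move/(pcan_inj pickleK): kE => [/codeI VE /codeI UE].
  rewrite -UE ?inE //; apply: sU; rewrite yx; apply: Vs.
  by rewrite VE ?inE.
exists (fun k => S (sel k)), (fun k => q (sel k)); split=> //.
- by move=> k; exact: limit_projM.
- by move=> k x; exact: near_limit_proj.
move=> x y xy; apply: (limit_proj_inj fK) => i.
have [k kx] := qU y _ (near_limit_proj fC i y).
exact: kx (xy k).
Qed.

Lemma logn2_odd m j : logn 2 (2 ^ m * j.*2.+1) = m.
Proof.
rewrite lognM ?expn_gt0 // pfactorK // logn_coprime ?addn0 //.
by rewrite coprime2n /= odd_double.
Qed.

Section ProfiniteEmbedding.
Context {R : realType}.

Local Notation C n := (croots R (2 ^ n.+1)).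
Local Notation W n := (wreath (C n) (Zset n.+1)).
Local Notation WW := (prod_topology (fun n => discrete_topology (W n))).

Lemma profinite_isomorphic (T : tsemigroupType) :
  profinite T -> @second_countable T ->
  exists A : set (superextension int), topologically_isomorphic T A.
Proof.
move=> prof count.
have [S [p [Sfin pM pC pU pI]]] := profinite_proj_sequence prof count.
(* Every factor [S m] is offered infinitely many levels [n], so it is embedded
   at one that is large enough. *)
pose emb m n (J : S m -> W n) := {morph J : s t / (s * t)%g} /\ injective J.
(* At a level admitting no embedding of its factor, the constant unit keeps [J n] multiplicative. *)
pose J n (x : T) : W n :=
  if pselect (exists J, @emb (logn 2 n.+1) n J) is left e
  then projT1 (cid e) (p _ x) else (fun=> rootz n 0, id).
have JM n : {morph J n : x y / (x * y)%g}.
  move=> x y; rewrite /J; case: pselect => [e|_].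
    by case: cid => K /= [KM _]; rewrite pM KM.
  by congr pair; apply/funext => z /=; rewrite rootz0.
have J_near n x : \forall y \near x, J n y = J n x.
  by apply: filterS (pC (logn 2 n.+1) x) => y yx; rewrite /J yx.
have J_inj m : exists n, forall x y, J n x = J n y -> p m x = p m y.
  have [k kemb] := finite_semigroup_wreath (R := R) (Sfin m).
  (* [n.+1] has 2-adic valuation [m], and its odd cofactor [2k + 1] makes [n >= k]. *)
  pose n := (2 ^ m * k.*2.+1).-1.
  have n1 : n.+1 = (2 ^ m * k.*2.+1)%N by rewrite prednK // muln_gt0 expn_gt0.
  have mE : m = logn 2 n.+1 by rewrite n1 logn2_odd.
  have kn : (k <= n)%N.
    rewrite -ltnS n1; apply: leq_trans (leq_pmull _ _); first by lia.
    by rewrite expn_gt0.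
  exists n => x y; rewrite /J; move: (kemb n kn) mE.
  move: (logn 2 n.+1) => m' e mE; subst m'; case: pselect => [e'|/(_ e)//].
  by case: cid => K /= [_ KI] /KI.
pose j (x : T) : WW := fun n => J n x.
pose F x := of_wreath (j x).
exists (range F); apply: embedding_isomorphic.
- move=> x y; rewrite -of_wreathM; congr of_wreath.
  by apply: functional_extensionality_dep => n; exact: JM.
- move=> x y /(can_inj of_wreathK) xy; apply: pI => m; have [n] := J_inj m.
  by apply; exact: (congr1 (fun w : WW => w n) xy).
- move=> x; apply: (@continuous_comp _ _ _ j of_wreath).
    apply: continuous_prod_topology => n; apply: continuous_discrete => {}x.
    exact: J_near.
  exact: of_wreath_continuous.
(* A single level [n] already determines the fibre of [p m], and coordinate [n] of [to_wreath] is
   locally constant. *)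
move=> x U /pU[m mU]; have [n nJ] := J_inj m.
have : \forall l \near F x, (to_wreath l : WW) n = (to_wreath (F x) : WW) n.
  apply: (@near_discrete _ (discrete_topology (W n))
    (fun l => (to_wreath l : WW) n)).
  apply: (@continuous_comp _ _ _ to_wreath (fun w : WW => w n)).
    exact: to_wreath_continuous.
  exact: prod_topology_proj_continuous.
apply: filterS => l lE y Fy; apply/mU/nJ; rewrite -Fy !of_wreathK in lE.
exact: lE.
Qed.

End ProfiniteEmbedding.

Theorem theorem21p1 (R : realType) :
  [/\ exists x : superextension int,
        topologically_isomorphic
          (prod_topology (fun n : nat => discrete_topology
             (wreath (croots R (2 ^ n.+1)) (Zset n.+1))))
          (principal_left_ideal x),
      forall L : set (superextension int), minimal_left_ideal L ->
        topologically_isomorphic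
          (left_zero_semigroup cantor_space *
             prod_topology (fun n : nat => discrete_topology
               (croots R (2 ^ n.+1))))%type
          L,
      forall K G : set (superextension int),
        minimal_ideal K -> maximal_group K G ->
        topologically_isomorphic
          (prod_topology (fun n : nat => discrete_topology
             (croots R (2 ^ n.+1))))
          G
    & forall T : tsemigroupType,
        topological_semigroup T -> profinite T -> @second_countable T ->
        exists A : set (superextension int), topologically_isomorphic T A].
Proof.
split.
- by exists (retraction (R := R)); exact: principal_retraction_isomorphic.
- exact: minimal_left_ideal_isomorphic.
- exact: maximal_group_isomorphic.
- by move=> T _; exact: (profinite_isomorphic (R := R)).
Qed.
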